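(* Let $r,s$ be integers with $s\ge r$, and let $a_1,\dots,a_{r-1},b_1,\dots,b_s,c,x,t$ be complex numbers such that $x$ and $b_i$ ($1\le i\le s$) are not of the form $q^{-n}$ for positive integers $n$. Then \[ {}_{r}\phi _{s}\left[\begin{matrix}a_{1},\dots,a_{r-1},c/x\\ b_{1},\dots,b_s\end{matrix} ; q, xt\right] =\sum_{n=0}^{\infty}{}_{r+1}\phi _{s+1}\left[\begin{matrix}q^{-n},a_{1},\dots,a_{r-1},cq^{n}\\ b_{1},\dots,b_{s},q\end{matrix}; q, tq\right]\frac{(c/x;q)_n }{(x;q)_{n+1}}(1-cq^{2n})\tau(n)\,x^n. \]
   Context: Fix $q\in\mathbb{C}$ with $|q|<1$. $(a;q)_\infty=\prod_{k\ge0}(1-aq^k)$, $(a;q)_n=(a;q)_\infty/(aq^n;q)_\infty$, $(a_1,\dots,a_m;q)_n=\prod_j(a_j;q)_n$, $\tau(n)=(-1)^nq^{\binom n2}$. ${}_{r}\phi _{s}\left[\begin{matrix}a_{1},\dots ,a_{r}\\ b_{1},\dots ,b_{s}\end{matrix}; q, z\right]=\sum_{n\ge0}\frac{(a_1,\dots,a_r;q)_n}{(b_1,\dots,b_s;q)_n}\tau(n)^{1+s-r}\frac{z^n}{(q;q)_n}$.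
   Formalization: x and the b_i are required not to be of the form q^{-n} for all n ≥ 0 (not only positive n), since at x = 1 or b_i = 1 the formula divides by zero; q and x are also taken nonzero, as q^{-n} and c/x require. *)

(* Defs.v *)
From mathcomp Require Import all_boot all_order all_algebra.
From mathcomp Require Import complex.
From mathcomp Require Import all_classical all_reals all_analysis.

Set Implicit Arguments.
Unset Strict Implicit.
Unset Printing Implicit Defensive.

Import Order.TTheory GRing.Theory Num.Theory.
Import numFieldNormedType.Exports.

Local Open Scope classical_set_scope.
Local Open Scope ring_scope.

(* Packaging R[i] as a numClosedFieldType gives it the topology of its norm,
   which is not declared on R[i] itself. *)
Definition complexType (R : realType) : numClosedFieldType := R[i].

(* The quotient (a;q)_oo / (a q^n;q)_oo is 0/0 at a = q^(-N), N >= n, although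
   terminating series use such parameters; (a;q)_n is therefore the finite
   product. By qpoch_ratio it is the quotient wherever the denominator is
   nonzero. *)
Definition qpoch (K : numClosedFieldType) (q a : K) (n : nat) : K :=
  \prod_(0 <= k < n) (1 - a * q ^+ k).

Definition qpoch_inf (K : numClosedFieldType) (q a : K) : K :=
  limn (qpoch q a).

Definition qpochs (K : numClosedFieldType) (q : K) (a : seq K) (n : nat) : K :=
  \prod_(y <- a) qpoch q y n.

Definition qtau (K : numClosedFieldType) (q : K) (n : nat) : K :=
  (-1) ^+ n * q ^+ 'C(n, 2).

(* With r = size a and s = size b, the exponent 1 + s - r of qtau is an integer,
   which may be negative for arbitrary a and b. *)
Definition qhyp_term (K : numClosedFieldType) (q : K) (a b : seq K) (z : K)
    (n : nat) : K :=
  qpochs q a n / qpochs q b n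
  * qtau q n ^ (1 + (size b)%:Z - (size a)%:Z) * (z ^+ n / qpoch q q n).

Definition qhyp (K : numClosedFieldType) (q : K) (a b : seq K) (z : K) : K :=
  limn (series (qhyp_term q a b z)).

Lemma qpochD (K : numClosedFieldType) (q a : K) (n m : nat) :
  qpoch q a (m + n) = qpoch q a n * qpoch q (a * q ^+ n) m.
Proof.
rewrite /qpoch (@big_cat_nat _ _ _ n) ?leq_addl //=; congr (_ * _).
rewrite -{1}[n]add0n big_addn addnK; apply: eq_bigr => k _.
by rewrite -mulrA -exprD addnC.
Qed.

Lemma qpoch_ratio (K : numClosedFieldType) (q a : K) (n : nat) :
  qpoch_inf q (a * q ^+ n) != 0 ->
  qpoch q a n = qpoch_inf q a / qpoch_inf q (a * q ^+ n).
Proof.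
move=> inf0; have cv : cvgn (qpoch q (a * q ^+ n)).
  apply: contrapT => dv; move/eqP: inf0; apply.
  by rewrite /qpoch_inf (dvgP dv).
suff -> : qpoch_inf q a = qpoch q a n * qpoch_inf q (a * q ^+ n).
  by rewrite mulfK.
apply: cvg_lim => //; rewrite -(cvg_shiftn n).
under eq_fun do rewrite qpochD.
by apply: cvgM cv; exact: cvg_cst.
Qed.

(* Main.v *)
Require Import Defs.
From mathcomp Require Import all_boot all_order all_algebra.
From mathcomp Require Import all_classical all_reals all_analysis.
From mathcomp Require Import complex ring lra.
Import Order.TTheory GRing.Theory Num.Theory.
Import numFieldNormedType.Exports.
Local Open Scope classical_set_scope.
Local Open Scope ring_scope.

(** Write the k-th term of the inner series on the right as A_k P_k(n), where
A_k collects the factors free of n and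
  P_k(n) = (q^-n)_k (c q^n)_k q^k / (q)_k      ([qkernel]),
and let u_n be the factor that multiplies the inner series ([qweight] times
1 - c q^(2n)). Exchanging the two sums reduces the theorem to
  sum_n u_n P_k(n) = x^k (c/x)_k               for every k.
With R_n = tau(n) x^n (c/x)_n / (x)_n ([qremainder]), u_n = R_n - R_(n+1), which
is the case k = 0; and the difference of P_(k+1) is a multiple of P_k with c
replaced by c q, so that summation by parts gives the step from k to k+1.

For the exchange, tau(n) (q^-n)_k q^k = tau(n-k) (q^(n-k+1))_k bounds u_n P_k(n)
by a superexponentially small factor in n-k times a geometric one in k; since A_k
decays superexponentially (this uses s >= r), Tannery's theorem applies. *)

(** * Real-valued modulus on the complex numbers and Tannery's theorem *)

Lemma cvg_sum0 (K : numFieldType) n (f : nat -> nat -> K) :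
  (forall k, f N k @[N --> \oo] --> (0 : K)) ->
  \sum_(0 <= k < n) f N k @[N --> \oo] --> (0 : K).
Proof.
move=> f0.
have z : \sum_(0 <= k < n) (0 : K) = 0 by rewrite big1.
have : \sum_(0 <= k < n) f N k @[N --> \oo] --> \sum_(0 <= k < n) (0 : K).
  apply: cvg_big => //; exact: add_continuous.
by rewrite z.
Qed.

Section Modulus.
Variable R : realType.
Local Notation K := (complexType R).
Implicit Types z w : K.

(* The norm of [K] takes its values in [K], which is only partially ordered. *)
Definition cmod z : R := Normc.normc z.

Lemma normE z : `|z| = (cmod z)%:C%C :> K.
Proof. by []. Qed.

Lemma cmod_ge0 z : 0 <= cmod z.
Proof. by case: z => x y; exact: sqrtr_ge0. Qed.

Lemma cmodM z w : cmod (z * w) = cmod z * cmod w.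
Proof. exact: Normc.normcM. Qed.

Lemma cmod0 : cmod 0 = 0.
Proof. exact: Normc.normc0. Qed.

Lemma cmod1 : cmod 1 = 1.
Proof. exact: Normc.normc1. Qed.

Lemma cmodV z : cmod z^-1 = (cmod z)^-1.
Proof. exact: Normc.normcV. Qed.

Lemma cmodN z : cmod (- z) = cmod z.
Proof. exact: normcN. Qed.

Lemma cmodD z w : cmod (z + w) <= cmod z + cmod w.
Proof. exact: le_normcD. Qed.

Lemma cmodB z w : cmod (z - w) <= cmod z + cmod w.
Proof. by rewrite -(cmodN w) cmodD. Qed.

Lemma cmodX z n : cmod (z ^+ n) = cmod z ^+ n.
Proof. by elim: n => [|n IH]; rewrite ?expr0 ?cmod1// !exprS cmodM IH. Qed.

Lemma cmod_gt0 z : (0 < cmod z) = (z != 0).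
Proof.
rewrite lt_neqAle cmod_ge0 andbT eq_sym; congr (~~ _).
by apply/eqP/eqP => [/Normc.eq0_normc//|->]; exact: cmod0.
Qed.

Lemma cmod_le_sum (I : Type) (r : seq I) (P : pred I) (F : I -> K) :
  cmod (\sum_(i <- r | P i) F i) <= \sum_(i <- r | P i) cmod (F i).
Proof.
elim/big_ind2: _ => //; first by rewrite cmod0.
by move=> a b c d ab cd; apply: le_trans (cmodD _ _) _; exact: lerD.
Qed.

Definition re_part z : R := @complex.Re R z.
Definition im_part z : R := @complex.Im R z.

Lemma norm_ltC z (e : R) : (`|z| < e%:C%C :> K) = (cmod z < e).
Proof. by rewrite normE; exact: ltcR. Qed.

Lemma cvg_cmodP (u : K ^nat) (l : K) :
  u @ \oo --> l <-> cmod (u n - l) @[n --> \oo] --> 0.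
Proof.
split=> [/cvgrPdist_lt cu|/cvgrPdist_lt cu]; apply/cvgrPdist_lt => e e0.
  have eC : 0 < e%:C%C :> K by exact: (etrans (ltcR 0 e) e0).
  near=> n; rewrite sub0r normrN ger0_norm ?cmod_ge0// -norm_ltC distrC.
  by near: n; exact: cu.
(* In the partial order of [K] a positive element has zero imaginary part, so [e] is a real
   number. *)
have eR : (re_part e)%:C%C = e.
  by move: e0; case: (e) => a b; rewrite ltcE/= => /andP[/eqP -> _].
have e0' : 0 < re_part e by move: e0; rewrite -{1}eR; exact: (etrans (esym (ltcR 0 _))).
near=> n; rewrite -eR distrC norm_ltC.
have : `|0 - cmod (u n - l)| < re_part e by near: n; exact: cu.
by rewrite sub0r normrN ger0_norm ?cmod_ge0.
Unshelve. all: by end_near. Qed.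

Lemma squeeze_cmod0 (u : K ^nat) (g : R ^nat) :
  (\forall n \near \oo, cmod (u n) <= g n) -> g @ \oo --> 0 -> u @ \oo --> 0.
Proof.
move=> ug g0; apply/cvg_cmodP; apply: (@squeeze_cvgr _ _ _ _ (cst 0) g) => //.
  by near=> n; rewrite subr0 cmod_ge0/=; near: n; exact: ug.
exact: cvg_cst.
Unshelve. all: by end_near. Qed.

Lemma ReD z w : re_part (z + w : K) = re_part z + re_part w.
Proof. by case: z w => ? ? []. Qed.
Lemma ImD z w : im_part (z + w : K) = im_part z + im_part w.
Proof. by case: z w => ? ? []. Qed.

Lemma cmod_ge_Re z : `|re_part z| <= cmod z.
Proof.
case: z => x y; rewrite /= -sqrtr_sqr ler_sqrt ?addr_ge0 ?sqr_ge0//.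
by rewrite lerDl sqr_ge0.
Qed.

Lemma cmod_ge_Im z : `|im_part z| <= cmod z.
Proof.
case: z => x y; rewrite /= -sqrtr_sqr ler_sqrt ?addr_ge0 ?sqr_ge0//.
by rewrite lerDr sqr_ge0.
Qed.

Lemma cmod_le_ReIm z : cmod z <= `|re_part z| + `|im_part z|.
Proof.
case: z => x y; rewrite /cmod/re_part/im_part/=.
rewrite -(@ler_pXn2r _ 2) ?nnegrE ?addr_ge0 ?sqrtr_ge0//.
rewrite sqr_sqrtr ?addr_ge0 ?sqr_ge0// sqrrD !real_normK ?num_real// addrAC.
by rewrite lerDl mulrn_wge0 ?mulr_ge0.
Qed.

Lemma geometric_half_series_le (C : R) n : 0 <= C ->
  \sum_(0 <= k < n) C / 2 ^+ k <= 2 * C.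
Proof.
move=> C0; suff -> : \sum_(0 <= k < n) C / 2 ^+ k = 2 * C - 2 * C / 2 ^+ n.
  by rewrite lerBlDr lerDl divr_ge0 ?mulr_ge0 ?exprn_ge0.
elim: n => [|n IH]; first by rewrite big_nil expr0 divr1 subrr.
by rewrite big_nat_recr//= IH exprS; field.
Qed.

Lemma cvg_half_series (C : R) : cvgn (series (fun k => C / 2 ^+ k)).
Proof.
rewrite [X in series X](_ : _ = geometric C 2^-1); last first.
  by apply/funext => k; rewrite /= exprVn.
by apply: is_cvg_geometric_series; rewrite ger0_norm ?invf_lt1 ?ltr1n.
Qed.

Lemma cvg_half_geometric (C : R) : C / 2 ^+ n @[n --> \oo] --> 0.
Proof. exact: cvg_series_cvg_0 (cvg_half_series C). Qed.

(** Real and imaginary parts are dominated by the modulus, so both series converge absolutely by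
    comparison in [R]; their limits are the parts of the complex sum. *)
Lemma abs_cvg_complex (u : K ^nat) (C : R) :
  (forall k, cmod (u k) <= C / 2 ^+ k) -> cvgn (series u).
Proof.
move=> uC.
have real_part (f : K -> R) : (forall z, `|f z| <= cmod z) ->
    cvgn (series (f \o u)).
  move=> fc; apply: normed_cvg; apply: series_le_cvg (cvg_half_series C) => //.
  - by move=> n; exact: normr_ge0.
  - by move=> n; exact: le_trans (cmod_ge0 _) (uC n).
  - by move=> n; exact: le_trans (fc _) (uC n).
have /cvg_ex[/= x xl] := real_part re_part cmod_ge_Re.
have /cvg_ex[/= y yl] := real_part im_part cmod_ge_Im.
have Re_sum n : re_part (series u n) = series (re_part \o u) n.
  elim: n => [|n IH]; first by rewrite /series/= !big_nil.
  by move: IH; rewrite /series/= !big_nat_recr//= ReD => ->.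
have Im_sum n : im_part (series u n) = series (im_part \o u) n.
  elim: n => [|n IH]; first by rewrite /series/= !big_nil.
  by move: IH; rewrite /series/= !big_nat_recr//= ImD => ->.
apply: (cvgP ((x +i* y)%C : K)); apply/cvg_cmodP.
pose g n := `|series (re_part \o u) n - x| + `|series (im_part \o u) n - y|.
apply: (@squeeze_cvgr _ _ _ _ (cst 0) g); [|exact: cvg_cst|].
  near=> n; rewrite cmod_ge0/= (le_trans (cmod_le_ReIm _))//.
  by rewrite ReD ImD Re_sum Im_sum.
rewrite /g -[X in _ --> X](addr0 (0:R)).
by apply: cvgD; apply/norm_cvg0P/subr_cvg0.
Unshelve. all: by end_near. Qed.

(** The difference from the partial sums of [g] is split at a fixed m: the head is a finite sum of
    null sequences, the tail is small uniformly in N. Domination of [f N k] is asked only for k < N,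
    the range of the sum. *)
Lemma tannery (f : nat -> nat -> K) (g : K ^nat) (C : R) (l : K) :
  (forall N k, (k < N)%N -> cmod (f N k) <= C / 2 ^+ k) ->
  (forall k, cmod (g k) <= C / 2 ^+ k) ->
  (forall k, f N k @[N --> \oo] --> g k) ->
  series g @ \oo --> l -> \sum_(0 <= k < N) f N k @[N --> \oo] --> l.
Proof.
move=> fC gC fg gl.
have C0 : 0 <= C.
  by have := gC 0; rewrite expr0 divr1; apply: le_trans; exact: cmod_ge0.
suff d0 : \sum_(0 <= k < N) (f N k - g k) @[N --> \oo] --> (0 : K).
  have fgE : (fun N => \sum_(0 <= k < N) (f N k - g k)) =
      (fun N => \sum_(0 <= k < N) f N k) - series g.
    by apply/funext => N; rewrite sumrB.
  rewrite fgE in d0; exact: cvg_sub0 d0 gl.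
apply/cvg_cmodP/cvgrPdist_lt => e e0.
(* Each tail difference is at most 2C/2^k, and these bounds add up to at most 4C/2^m from k = m
   on. *)
have [m me] : exists m, 4 * C / 2 ^+ m < e / 2.
  have /cvgrPdist_lt/(_ _ (divr_gt0 e0 (ltr0n R 2)))[m _ /(_ _ (leqnn m))/=] :=
    cvg_half_geometric (4 * C).
  rewrite sub0r normrN ger0_norm; last by rewrite divr_ge0 ?exprn_ge0 ?mulr_ge0.
  by exists m.
have sm : \sum_(0 <= k < m) cmod (f N k - g k) @[N --> \oo] --> 0.
  apply: (@cvg_sum0 R m (fun N k => cmod (f N k - g k))) => k.
  by have [cu _] := cvg_cmodP (f^~ k) (g k); exact: cu (fg k).
near=> N.
have mN : (m <= N)%N by near: N; exact: nbhs_infty_ge.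
rewrite subr0 sub0r normrN ger0_norm ?cmod_ge0//.
apply: le_lt_trans (cmod_le_sum _ _ _ _) _.
rewrite (@big_cat_nat _ _ _ m)//= [e]splitr; apply: ltrD.
  have : `|0 - \sum_(0 <= k < m) cmod (f N k - g k)| < e / 2.
    by near: N; move/cvgrPdist_lt: sm; apply; rewrite divr_gt0.
  by rewrite sub0r normrN ger0_norm// sumr_ge0// => ? _; exact: cmod_ge0.
apply: le_lt_trans me.
rewrite -{1}[m]add0n big_addn.
apply: (@le_trans _ _ (\sum_(0 <= i < N - m) (2 * C / 2 ^+ m) / 2 ^+ i)); last first.
  apply: le_trans (geometric_half_series_le _ _ _) _.
    by rewrite divr_ge0 ?mulr_ge0 ?exprn_ge0.
  by rewrite !mulrA -natrM.
rewrite big_nat_cond [leRHS]big_nat_cond; apply: ler_sum => i /andP[/andP[_ iN] _].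
apply: le_trans (cmodB _ _) _.
have -> : 2 * C / 2 ^+ m / 2 ^+ i = C / 2 ^+ (i + m) + C / 2 ^+ (i + m).
  by rewrite exprD; field; rewrite !expf_neq0.
by apply: lerD; [apply: fC; rewrite addnC -ltn_subRL|exact: gC].
Unshelve. all: by end_near. Qed.

End Modulus.

Arguments cmod {R}.

(** * Finite q-Pochhammer symbols and the kernel P_k(n) *)

Section Pochhammer.
Variables (K : numClosedFieldType) (q : K).
Implicit Types a : K.

Lemma qpoch0 a : qpoch q a 0 = 1.
Proof. by rewrite /qpoch big_geq. Qed.

Lemma qpochSr a n : qpoch q a n.+1 = qpoch q a n * (1 - a * q ^+ n).
Proof. by rewrite /qpoch big_nat_recr. Qed.

Lemma qpochSl a n : qpoch q a n.+1 = (1 - a) * qpoch q (a * q) n.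
Proof. by rewrite -addn1 qpochD qpochSr qpoch0 expr0 expr1 mulr1 mul1r. Qed.

Lemma qtau0 : qtau q 0 = 1.
Proof. by rewrite /qtau bin0n !expr0 mulr1. Qed.

Lemma qtauS n : qtau q n.+1 = - q ^+ n * qtau q n.
Proof. by rewrite /qtau binS bin1 addnC exprD exprS; ring. Qed.

Hypothesis q_neq0 : q != 0.

Lemma one_sub_neq0 a k : a != q ^- k -> 1 - a * q ^+ k != 0.
Proof.
apply: contra; rewrite subr_eq0 => /eqP aq1.
by rewrite -[a](mulfK (expf_neq0 k q_neq0)) -aq1 mul1r.
Qed.

Lemma qpoch_neq0 a n : (forall k, a != q ^- k) -> qpoch q a n != 0.
Proof.
move=> ha; elim: n => [|n IH]; first by rewrite qpoch0 oner_neq0.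
by rewrite qpochSr mulf_neq0 // one_sub_neq0.
Qed.

(** The factor of index n is 1 - q^-n q^n = 0; this makes the inner series terminate. *)
Lemma qpoch_qN_eq0 n k : (n < k)%N -> qpoch q (q ^- n) k = 0.
Proof.
move=> nk; rewrite -(subnK nk) addnC addnC qpochD qpochSr.
by rewrite mulVf ?expf_neq0// subrr mulr0 mul0r.
Qed.

(** With n = m + k, each factor 1 - q^(i-n) equals -q^(i-n) (1 - q^(n-i)). The factors 1 - q^(n-i)
    form (q^(m+1))_k in reverse order, and the powers of q taken out turn tau(n) q^k into tau(m). *)
Lemma qpoch_qN_reverse m k :
  qtau q (m + k) * qpoch q (q ^- (m + k)) k * q ^+ k =
  qtau q m * qpoch q (q ^+ m.+1) k.
Proof.
elim: k => [|k IH]; first by rewrite addn0 !qpoch0 expr0 !mulr1.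
rewrite addnS qpochSl qtauS [in RHS]qpochSr mulrA -IH.
have -> : q ^- (m + k).+1 * q = q ^- (m + k).
  by rewrite exprS invfM mulrAC mulVf ?mul1r.
have qmk := expf_neq0 (m + k) q_neq0.
rewrite exprS -exprD addSn !exprS; move: qmk; set Q := q ^+ (m + k) => qmk.
by field; rewrite qmk q_neq0.
Qed.

Hypothesis q_lt1 : `|q| < 1.

Lemma q_neq_qN n : q != q ^- n.
Proof.
apply/eqP => /(congr1 (fun z => `|z * q ^+ n|)).
rewrite mulVf ?expf_neq0// -exprS normrX normr1 => /eqP.
by rewrite lt_eqF// exprn_ilt1.
Qed.

Lemma qpoch_qq_neq0 k : qpoch q q k != 0.
Proof. by apply: qpoch_neq0 => n; exact: q_neq_qN. Qed.

Definition qkernel c k n :=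
  qpoch q (q ^- n) k * qpoch q (c * q ^+ n) k / qpoch q q k * q ^+ k.

Lemma qkernel0 c n : qkernel c 0 n = 1.
Proof. by rewrite /qkernel !qpoch0 expr0 divr1 !mulr1. Qed.

Lemma qkernel_eq0 c k n : (n < k)%N -> qkernel c k n = 0.
Proof. by move=> nk; rewrite /qkernel qpoch_qN_eq0// !mul0r. Qed.

(** Both terms on the left contain (q^-n)_k (c q^(n+1))_k, which is also the numerator of P_k(n) at
    c q; what remains is a rational identity in q^n and q^k. *)
Lemma qkernel_diff c k n :
  qkernel c k.+1 n.+1 - qkernel c k.+1 n =
  - q ^- n * qkernel (c * q) k n * (1 - c * q ^+ (2 * n).+1).
Proof.
have qn := expf_neq0 n q_neq0.
have := qpoch_qq_neq0 k.+1; rewrite qpochSr mulf_eq0 negb_or => /andP[qk qk1].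
rewrite /qkernel qpochSl.
have -> : q ^- n.+1 * q = q ^- n.
  by rewrite exprS invfM mulrAC mulVf ?mul1r.
rewrite [qpoch q (q ^- n) k.+1]qpochSr [qpoch q (c * q ^+ n) k.+1]qpochSl.
rewrite [qpoch q (c * q ^+ n.+1) k.+1]qpochSr [qpoch q q k.+1]qpochSr.
have -> : c * q ^+ n * q = c * q ^+ n.+1 by rewrite exprSr mulrA.
have -> : c * q * q ^+ n = c * q ^+ n.+1 by rewrite exprS mulrA.
rewrite [q ^+ (2 * n).+1]exprS mulnC exprM !exprS.
move: qn qk qk1.
set Q := q ^+ n; set L := q ^+ k; set A := qpoch _ _ _; set B := qpoch _ _ _.
set D := qpoch q q k => qn qk qk1.
by field; rewrite qn q_neq0 qk1 qk.
Qed.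

(** * Weights, telescoping and summation by parts *)

Variable x : K.
Hypothesis x_neq0 : x != 0.
Hypothesis hx : forall n : nat, x != q ^- n.

(** The factor 1 - c q^(2n) is kept apart: when c becomes c q, its shifted form comes from
    [qkernel_diff] and the shifted weight from [qweight_shift]. *)
Definition qweight c n :=
  qtau q n * x ^+ n * (qpoch q (c / x) n / qpoch q x n.+1).

Definition qremainder c n :=
  qtau q n * x ^+ n * (qpoch q (c / x) n / qpoch q x n).

Lemma qremainderS c n :
  qremainder c n.+1 = - (x * q ^+ n - c * q ^+ (2 * n)) * qweight c n.
Proof.
rewrite /qremainder /qweight qtauS [qpoch q (c / x) n.+1]qpochSr.
rewrite mulnC exprM exprS; have := qpoch_neq0 x n.+1 hx.
set D := qpoch q x n.+1 => D0.
by field; rewrite D0 x_neq0.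
Qed.

(** With w_n for [qweight], R_n = (1 - x q^n) w_n and R_(n+1) = -(x q^n - c q^(2n)) w_n; the terms x
    q^n cancel in the difference. *)
Lemma qweight_telescope c n :
  qweight c n * (1 - c * q ^+ (2 * n)) = qremainder c n - qremainder c n.+1.
Proof.
rewrite qremainderS /qremainder /qweight mulnC exprM.
have := qpoch_neq0 x n.+1 hx; rewrite qpochSr mulf_eq0 negb_or => /andP[D0 D1].
move: D0 D1; set D := qpoch q x n => D0 D1.
by field; rewrite D0 D1.
Qed.

Definition qpartial c k N :=
  \sum_(0 <= n < N) qweight c n * (1 - c * q ^+ (2 * n)) * qkernel c k n.

Lemma qpartialS c k N : qpartial c k N.+1 =
  qpartial c k N + qweight c N * (1 - c * q ^+ (2 * N)) * qkernel c k N.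
Proof. by rewrite /qpartial big_nat_recr. Qed.

Lemma qpartial0 c N : qpartial c 0 N = 1 - qremainder c N.
Proof.
elim: N => [|N IH].
  by rewrite /qpartial big_geq// /qremainder qtau0 !qpoch0 expr0 divr1 !mulr1 subrr.
by rewrite qpartialS IH qkernel0 mulr1 qweight_telescope; ring.
Qed.

(** The factor q^-n left by [qkernel_diff] cancels against tau(n+1) = -q^n tau(n), and x (c/x)_(n+1)
    = (x - c) (c q/x)_n. *)
Lemma qweight_shift c n :
  q ^- n * qremainder c n.+1 = - (x - c) * qweight (c * q) n.
Proof.
rewrite /qremainder /qweight qtauS [qpoch q (c / x) n.+1]qpochSl.
have -> : c * q / x = c / x * q by rewrite mulrAC.
rewrite exprS; have := qpoch_neq0 x n.+1 hx; have := expf_neq0 n q_neq0.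
set D := qpoch q x n.+1; set Q := q ^+ n => Q0 D0.
by field; rewrite Q0 D0 x_neq0.
Qed.

(* Summation by parts: the backward difference of [qkernel c k.+1] is a multiple
   of [qkernel (c * q) k]. *)
Lemma qpartial_rec c k N : qpartial c k.+1 N.+1 =
  - qremainder c N.+1 * qkernel c k.+1 N + (x - c) * qpartial (c * q) k N.
Proof.
elim: N => [|N IH].
  by rewrite qpartialS /qpartial !big_geq// qkernel_eq0// !mulr0 !addr0.
rewrite qpartialS IH qweight_telescope [qpartial (c * q) k N.+1]qpartialS.
have -> : c * q * q ^+ (2 * N) = c * q ^+ (2 * N).+1 by rewrite exprS mulrA.
have := qkernel_diff c k N => /(canRL (subrK _)) ->.
set W := 1 - _; set V := qkernel _ k N; set T := qpartial _ _ _.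
set U := qkernel c k.+1 N.
have E := qweight_shift c N.
have -> : (x - c) * (T + qweight (c * q) N * W * V) =
  (x - c) * T - q ^- N * qremainder c N.+1 * W * V by rewrite E; ring.
ring.
Qed.

End Pochhammer.

Arguments qkernel {K}.
Arguments qweight {K}.
Arguments qremainder {K}.
Arguments qpartial {K}.

(** * Geometric and superexponential growth estimates *)

Section Bounds.
Variables (R : realType) (q : complexType R).
Local Notation K := (complexType R).
Hypothesis q_neq0 : q != 0.
Hypothesis q_lt1 : `|q| < 1.
Let rho : R := cmod q.

Lemma cmodq_lt1 : cmod q < 1.
Proof. by rewrite -norm_ltC. Qed.

Lemma rho_ge0 : 0 <= rho.
Proof. exact: cmod_ge0. Qed.

Lemma rho_le1 : rho <= 1.
Proof. exact: ltW cmodq_lt1. Qed.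

Lemma cmod_qX_le1 n : cmod (q ^+ n) <= 1.
Proof. by rewrite cmodX exprn_ile1 ?cmod_ge0 ?ltW ?cmodq_lt1. Qed.

Lemma cvg_cmodq_expn : rho ^+ n @[n --> \oo] --> (0 : R).
Proof. by apply: cvg_expr; rewrite ger0_norm ?cmod_ge0 ?cmodq_lt1. Qed.

Lemma cmodq_expn_lt (e : R) : 0 < e -> exists n, rho ^+ n < e.
Proof.
move=> e0; have /cvgrPdist_lt/(_ _ e0)[n _ /(_ _ (leqnn n))/=] := cvg_cmodq_expn.
by rewrite sub0r normrN ger0_norm ?exprn_ge0 ?cmod_ge0//; exists n.
Qed.

(** Passing from k to k+1 multiplies rho^C(k,2) (2M)^k by 2M rho^k. This is at most 1 + 2M always
    and at most 1 once k >= n, so the product never exceeds (1 + 2M)^n. *)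
Lemma superexponential_decay (M : R) : 0 <= M ->
  exists2 C, 0 <= C & forall k, rho ^+ 'C(k, 2) * M ^+ k <= C / 2 ^+ k.
Proof.
move=> M0; have M1 : 0 < 1 + 2 * M by lra.
have r0 : 0 <= rho by exact: cmod_ge0.
have [n nM] : exists n, rho ^+ n < (1 + 2 * M)^-1.
  by apply: cmodq_expn_lt; rewrite invr_gt0.
have wM k : rho ^+ 'C(k, 2) * (2 * M) ^+ k <= (1 + 2 * M) ^+ minn k n.
  elim: k => [|k IH]; first by rewrite bin0n min0n !expr0 mulr1.
  have -> : rho ^+ 'C(k.+1, 2) * (2 * M) ^+ k.+1 =
      (rho ^+ 'C(k, 2) * (2 * M) ^+ k) * (rho ^+ k * (2 * M)).
    by rewrite binS bin1 exprD exprS; ring.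
  have rk1 i : rho ^+ i <= 1 by rewrite exprn_ile1 ?rho_ge0 ?rho_le1.
  have [nk|kn] := leqP n k.
    rewrite (minn_idPr (leqW nk)) -[leRHS]mulr1 ler_pM ?mulr_ge0 ?exprn_ge0 ?mulr_ge0//.
    - by move: IH; rewrite (minn_idPr nk).
    - have : rho ^+ k <= (1 + 2 * M)^-1.
        by rewrite (le_trans _ (ltW nM))// ler_wiXn2l ?rho_ge0 ?rho_le1.
      move=> /(ler_wpM2r (ltW M1)); rewrite mulVf ?gt_eqF//; apply: le_trans.
      by rewrite ler_wpM2l ?exprn_ge0//; lra.
  rewrite (minn_idPl kn) exprSr; rewrite (minn_idPl (ltnW kn)) in IH.
  rewrite ler_pM ?mulr_ge0 ?exprn_ge0 ?mulr_ge0//.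
  apply: (@le_trans _ _ (1 * (2 * M))); last lra.
  by rewrite ler_wpM2r ?mulr_ge0.
exists ((1 + 2 * M) ^+ n); first by rewrite exprn_ge0 ?ltW.
move=> k; rewrite ler_pdivlMr ?exprn_gt0// -mulrA -exprMn [M * 2]mulrC.
apply: le_trans (wM k) _; rewrite ler_weXn2l ?geq_minr//; lra.
Qed.

(** No constant stands before [M ^+ n]: the sequences concerned equal 1 at n = 0, and the form is
    stable under products. *)
Definition geom_bounded (u : nat -> K) :=
  exists2 M, 0 <= M & forall n, cmod (u n) <= M ^+ n.

Lemma geom_boundedM u v :
  geom_bounded u -> geom_bounded v -> geom_bounded (fun n => u n * v n).
Proof.
move=> [M M0 uM] [L L0 vL]; exists (M * L); first by rewrite mulr_ge0.
by move=> n; rewrite cmodM exprMn ler_pM ?cmod_ge0.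
Qed.

Lemma geom_bounded_exp (z : K) : geom_bounded (fun n => z ^+ n).
Proof. by exists (cmod z); [exact: cmod_ge0|move=> n; rewrite cmodX]. Qed.

Lemma cmod_qpoch_le (a : K) (A : R) n :
  cmod a <= A -> cmod (qpoch q a n) <= (1 + A) ^+ n.
Proof.
move=> aA; elim: n => [|n IH]; first by rewrite qpoch0 cmod1.
rewrite qpochSr cmodM exprSr ler_pM ?cmod_ge0//.
apply: le_trans (cmodB _ _ _) _; rewrite cmod1 lerD2l cmodM -[leRHS]mulr1.
by rewrite ler_pM ?cmod_ge0 ?cmod_qX_le1.
Qed.

Lemma geom_bounded_qpoch (a : K) : geom_bounded (qpoch q a).
Proof.
exists (1 + cmod a); first by rewrite addr_ge0 ?cmod_ge0.
by move=> n; exact: cmod_qpoch_le.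
Qed.

(** Since a q^k tends to 0, the modulus is at least 1/2 from some n on; the finitely many earlier
    factors are nonzero and have a positive minimum. *)
Lemma one_sub_bounded_below (a : K) : (forall k, a != q ^- k) ->
  exists2 e : R, 0 < e & forall k, e <= cmod (1 - a * q ^+ k).
Proof.
move=> ha.
have [n n_half] : exists n, forall k, (n <= k)%N ->
    1 / 2 <= cmod (1 - a * q ^+ k).
  have A0 : 0 < 1 + cmod a by rewrite ltr_wpDr ?cmod_ge0.
  have [n nA] : exists n, rho ^+ n < (2 * (1 + cmod a))^-1.
    by apply: cmodq_expn_lt; rewrite invr_gt0 mulr_gt0.
  exists n => k nk.
  have := cmodD R (1 - a * q ^+ k) (a * q ^+ k); rewrite subrK cmod1 cmodM cmodX.
  suff : cmod a * rho ^+ k <= 1 / 2 by rewrite /rho; lra.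
  have rk : rho ^+ k <= (2 * (1 + cmod a))^-1.
    by rewrite (le_trans _ (ltW nA))// ler_wiXn2l ?rho_ge0 ?rho_le1.
  apply: (@le_trans _ _ ((1 + cmod a) * (2 * (1 + cmod a))^-1)).
    by rewrite ler_pM ?cmod_ge0 ?exprn_ge0 ?rho_ge0 ?lerDr ?ler01.
  by rewrite invfM mulrCA mulfV ?gt_eqF// mulr1 div1r.
have [e e0 ne] : exists2 e : R, 0 < e &
    forall k, (k < n)%N -> e <= cmod (1 - a * q ^+ k).
  elim: (n) => [|m [e e0 me]]; first by exists 1.
  have am : 0 < cmod (1 - a * q ^+ m) by rewrite cmod_gt0 one_sub_neq0.
  exists (Num.min e (cmod (1 - a * q ^+ m))); first by rewrite lt_min e0.
  move=> k; rewrite ltnS leq_eqVlt => /orP[/eqP ->|/me ke].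
    by rewrite ge_min lexx orbT.
  by rewrite ge_min ke.
exists (Num.min e (1 / 2)); first by rewrite lt_min e0/=; lra.
move=> k; have [nk|kn] := leqP n k; first by rewrite ge_min n_half// orbT.
by rewrite ge_min ne.
Qed.

Lemma geom_bounded_qpochV (a : K) : (forall k, a != q ^- k) ->
  geom_bounded (fun n => (qpoch q a n)^-1).
Proof.
move=> /one_sub_bounded_below[e e0 ae]; exists e^-1; first by rewrite invr_ge0 ltW.
elim=> [|n IH]; first by rewrite qpoch0 invr1 cmod1.
rewrite qpochSr invfM cmodM exprSr ler_pM ?cmod_ge0//.
by rewrite cmodV lef_pV2 ?posrE// (lt_le_trans e0).
Qed.

Lemma geom_bounded_qpochs (a : seq K) : geom_bounded (qpochs q a).
Proof.
rewrite /qpochs; elim: a => [|y a IH].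
  by exists 1 => // n; rewrite big_nil cmod1 expr1n.
have [M M0 H] := geom_boundedM _ _ (geom_bounded_qpoch y) IH.
by exists M => // n; rewrite big_cons.
Qed.

Lemma geom_bounded_qpochsV (a : seq K) :
  (forall y, y \in a -> forall k, y != q ^- k) ->
  geom_bounded (fun n => (qpochs q a n)^-1).
Proof.
rewrite /qpochs; elim: a => [|y a IH] ha.
  by exists 1 => // n; rewrite big_nil invr1 cmod1 expr1n.
have hy : forall k, y != q ^- k by apply: ha; rewrite mem_head.
have [|M M0 H] := geom_boundedM _ _ (geom_bounded_qpochV y hy) (IH _).
  by move=> z za; apply: ha; rewrite inE za orbT.
by exists M => // n; rewrite big_cons invfM.
Qed.

Lemma cmod_qtau n : cmod (qtau q n) = rho ^+ 'C(n, 2).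
Proof. by rewrite /qtau cmodM !cmodX cmodN cmod1 expr1n mul1r. Qed.

(** This is A_k, with a natural exponent of tau. Both sides of the theorem have the same exponent 1
    + s - r, because the inner series raises r and s by one each. *)
Definition qcoef (a b : seq K) (e : nat) (t : K) (k : nat) : K :=
  qpochs q a k / qpochs q b k * qtau q k ^+ e * (t ^+ k / qpoch q q k).

(** One factor tau(k) supplies [rho ^+ 'C(k, 2)], the other [e] factors have modulus at most 1, and
    the rest grows geometrically. *)
Lemma qcoef_bound (a b : seq K) e t :
  (forall y, y \in b -> forall k, y != q ^- k) ->
  exists2 M, 0 <= M &
    forall k, cmod (qcoef a b e.+1 t k) <= rho ^+ 'C(k, 2) * M ^+ k.
Proof.
move=> hb.
have [M M0 H] := geom_boundedM _ _
  (geom_boundedM _ _ (geom_bounded_qpochs a) (geom_bounded_qpochsV b hb))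
  (geom_boundedM _ _ (geom_bounded_exp t)
    (geom_bounded_qpochV q (q_neq_qN _ q q_neq0 q_lt1))).
exists M => // k; rewrite /qcoef mulrAC cmodM [leRHS]mulrC.
rewrite ler_pM ?cmod_ge0 ?H// cmodX cmod_qtau exprS ler_piMr ?exprn_ge0 ?cmod_ge0//.
by rewrite exprn_ile1 ?exprn_ge0 ?exprn_ile1 ?rho_ge0 ?rho_le1.
Qed.

(** * Bounds and limits of the sums over n *)

Variable x : K.
Hypothesis x_neq0 : x != 0.
Hypothesis hx : forall n : nat, x != q ^- n.

(** After [qpoch_qN_reverse] the factor tau(m) remains. The geometric growth in n = m + k splits:
    its part in m is overcome by tau(m), its part in k goes into [M ^+ k]. *)
Lemma qweight_kernel_bound c : exists B M, [/\ 0 <= B, 0 <= M & forall k m,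
  cmod (qweight q x c (m + k) * qkernel q c k (m + k)) <= B / 2 ^+ m * M ^+ k].
Proof.
have [D1 D1_0 D1P] := geom_bounded_qpochV q (q_neq_qN _ q q_neq0 q_lt1).
have [G G0 GP] := geom_boundedM _ _ (geom_bounded_exp x) (geom_bounded_qpoch (c / x)).
have [D D0 DP] := geom_bounded_qpochV x hx.
have GD0 : 0 <= G * D by rewrite mulr_ge0.
have [C C0 CP] := superexponential_decay (G * D) GD0.
(* Per factor, 2 bounds (q^(m+1))_k, 1 + |c| bounds (c q^n)_k, D1 bounds 1/(q)_k, and G D bounds x^n
   (c/x)_n/(x)_n; the extra D comes from the index n+1 of (x)_(n+1). *)
exists (D * C), (2 * (1 + cmod c) * D1 * (G * D)); split.
- by rewrite mulr_ge0.
- by rewrite !mulr_ge0// addr_ge0 ?cmod_ge0.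
move=> k m; set n := (m + k)%N.
have -> : qweight q x c n * qkernel q c k n = (qtau q m * qpoch q (q ^+ m.+1) k) *
    (qpoch q (c * q ^+ n) k * (qpoch q q k)^-1) *
    ((x ^+ n * qpoch q (c / x) n) * (qpoch q x n.+1)^-1).
  by rewrite -qpoch_qN_reverse// /qweight /qkernel /n; ring.
have := cmod_qtau m; move: (qtau q m) => tm tmE; rewrite !cmodM tmE.
have -> : D * C / 2 ^+ m * (2 * (1 + cmod c) * D1 * (G * D)) ^+ k =
    (C / 2 ^+ m * (G * D) ^+ k * D) * ((1 + 1) ^+ k * ((1 + cmod c) ^+ k * D1 ^+ k)).
  by rewrite -[1 + 1]/(2%:R : R) !exprMn; ring.
apply: (@le_trans _ _ ((rho ^+ 'C(m, 2) * (G * D) ^+ m * (G * D) ^+ k * D) *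
   ((1 + 1) ^+ k * ((1 + cmod c) ^+ k * D1 ^+ k)))); last first.
  rewrite ler_wpM2r//.
    by rewrite !mulr_ge0 ?exprn_ge0// ?addr_ge0 ?cmod_ge0.
  by rewrite ler_wpM2r// ler_wpM2r ?exprn_ge0.
have -> : rho ^+ 'C(m, 2) * (G * D) ^+ m * (G * D) ^+ k * D *
    ((1 + 1) ^+ k * ((1 + cmod c) ^+ k * D1 ^+ k)) =
    (rho ^+ 'C(m, 2) * (1 + 1) ^+ k) * ((1 + cmod c) ^+ k * D1 ^+ k) *
    (G ^+ n * D ^+ n.+1).
  by rewrite /n exprS !exprMn !exprD; ring.
have cq : cmod (c * q ^+ n) <= cmod c.
  by rewrite cmodM -[leRHS]mulr1 ler_pM ?cmod_ge0 ?cmod_qX_le1.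
have GPn := GP n; rewrite cmodM in GPn.
have qm := cmod_qpoch_le _ _ k (cmod_qX_le1 m.+1).
have cqk := cmod_qpoch_le _ _ k cq.
apply: ler_pM; rewrite ?mulr_ge0 ?cmod_ge0 ?exprn_ge0 ?cmod_ge0//.
  apply: ler_pM; rewrite ?mulr_ge0 ?cmod_ge0 ?exprn_ge0 ?cmod_ge0//.
    by rewrite ler_wpM2l ?exprn_ge0 ?cmod_ge0.
  by apply: ler_pM; rewrite ?cmod_ge0 ?D1P.
by apply: ler_pM; rewrite ?mulr_ge0 ?cmod_ge0.
Qed.

(** This is the boundary term of the summation by parts. By [qremainderS] it is a bounded multiple
    of weight times kernel, which decays like 2^-m for N = m + k and fixed k. *)
Lemma qremainder_kernel_cvg0 c k :
  qremainder q x c N.+1 * qkernel q c k N @[N --> \oo] --> (0 : K).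
Proof.
have [B [M [B0 M0 BM]]] := qweight_kernel_bound c.
pose u N := qremainder q x c N.+1 * qkernel q c k N.
suff H : u (m + k)%N @[m --> \oo] --> (0 : K) by move: H; rewrite (cvg_shiftn k u).
pose g m := ((cmod x + cmod c) * B * M ^+ k) / 2 ^+ m.
apply: (squeeze_cmod0 _ _ g); last exact: cvg_half_geometric.
apply: nearW => m; rewrite /u qremainderS// -mulrA cmodM cmodN.
have -> : g m = (cmod x + cmod c) * (B / 2 ^+ m * M ^+ k) by rewrite /g; ring.
rewrite ler_pM ?cmod_ge0//.
apply: le_trans (cmodB _ _ _) _; rewrite !cmodM.
by apply: lerD; rewrite -[leRHS]mulr1 ler_pM ?cmod_ge0 ?cmod_qX_le1.
Qed.

(** Induction on k for all c at once, since [qpartial_rec] replaces c by c q. Its boundary term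
    vanishes in the limit, and (x - c) x^k (c q/x)_k = x^(k+1) (c/x)_(k+1). *)
Lemma qpartial_cvg c k : qpartial q x c k N @[N --> \oo] --> x ^+ k * qpoch q (c / x) k.
Proof.
elim: k c => [|k IH] c.
  pose u N := qpartial q x c 0 N.
  suff H : u (N + 1)%N @[N --> \oo] --> (1 : K).
    by move: H; rewrite (cvg_shiftn 1 u) qpoch0 expr0 mulr1.
  have c1 : (fun _ : nat => 1 : K) @ \oo --> (1 : K) by exact: cvg_cst.
  have uE : (fun N => u (N + 1)%N) = (fun N => 1 - qremainder q x c N.+1 * qkernel q c 0 N).
    by apply/funext => N; rewrite /u addn1 qpartial0// qkernel0 mulr1.
  have H : (fun N => 1 - qremainder q x c N.+1 * qkernel q c 0 N) @ \oo --> (1 - 0 : K).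
    by apply: cvgB c1 _; exact: qremainder_kernel_cvg0.
  by rewrite uE; move: H; rewrite subr0.
pose u N := qpartial q x c k.+1 N.
suff H : u (N + 1)%N @[N --> \oo] --> x ^+ k.+1 * qpoch q (c / x) k.+1.
  by move: H; rewrite (cvg_shiftn 1 u).
have lE : (x - c) * (x ^+ k * qpoch q (c * q / x) k) - 0 =
    x ^+ k.+1 * qpoch q (c / x) k.+1.
  by rewrite subr0 qpochSl [c * q / x]mulrAC exprS; field.
have uE : (fun N => u (N + 1)%N) = (fun N => (x - c) * qpartial q x (c * q) k N -
    qremainder q x c N.+1 * qkernel q c k.+1 N).
  by apply/funext => N; rewrite /u addn1 qpartial_rec//= addrC mulNr.
rewrite uE -lE; apply: cvgB; last exact: qremainder_kernel_cvg0.
by apply: cvgM; [exact: cvg_cst|exact: IH].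
Qed.

(** Uniformity in N is what Tannery's theorem needs. Terms with n < k vanish, and the others are
    dominated by a geometric series in n - k. *)
Lemma qpartial_bound c : exists B M, [/\ 0 <= B, 0 <= M & forall k N,
  (k < N)%N -> cmod (qpartial q x c k N) <= B * M ^+ k].
Proof.
have [B [M [B0 M0 BM]]] := qweight_kernel_bound c.
have c1 : 0 <= 1 + cmod c by rewrite addr_ge0 ?cmod_ge0.
exists (2 * ((1 + cmod c) * B)), M; split => //; first by rewrite !mulr_ge0.
move=> k N kN; rewrite /qpartial (@big_cat_nat _ _ _ k) ?(ltnW kN)//=.
rewrite big_nat_cond big1 ?add0r; last first.
  by move=> n /andP[/andP[_ nk] _]; rewrite qkernel_eq0// mulr0.
apply: le_trans (cmod_le_sum _ _ _ _ _) _.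
rewrite -{1}[k]add0n big_addn.
apply: (@le_trans _ _ (\sum_(0 <= m < N - k) ((1 + cmod c) * B * M ^+ k) / 2 ^+ m)).
  apply: ler_sum => m _; rewrite mulrAC mulrC cmodM.
  have -> : (1 + cmod c) * B * M ^+ k / 2 ^+ m =
    (1 + cmod c) * (B / 2 ^+ m * M ^+ k) by ring.
  rewrite ler_pM ?cmod_ge0//; apply: le_trans (cmodB _ _ _) _.
  rewrite cmod1 lerD2l cmodM -[leRHS]mulr1.
  by rewrite ler_pM ?cmod_ge0 ?cmod_qX_le1.
apply: le_trans (geometric_half_series_le _ _ _ _) _; last by rewrite !mulrA.
by rewrite !mulr_ge0 ?exprn_ge0.
Qed.

End Bounds.

Arguments qcoef {R}.

(** * Terms of both sides and exchange of the sums *)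

Lemma qpochs_rcons (K : numClosedFieldType) (q : K) a y n :
  qpochs q (rcons a y) n = qpochs q a n * qpoch q y n.
Proof. by rewrite /qpochs -cats1 big_cat big_seq1. Qed.

(** Here [size b - (size a).+1] is s - r, and the truncated subtraction is exact because
    [size a < size b]. *)
Lemma qhyp_termE (R : realType) (q : complexType R) (a b : seq (complexType R))
    (y z : complexType R) k :
  (size a < size b)%N ->
  qhyp_term q (rcons a y) b z k =
  qcoef q a b (size b - (size a).+1).+1 z k * qpoch q y k.
Proof.
move=> ab; rewrite /qhyp_term /qcoef qpochs_rcons size_rcons.
have -> : 1 + (size b)%:Z - (size a).+1%:Z = (size b - (size a).+1).+1%:Z.
  by rewrite -[X in _ = Posz X]addn1 PoszD -(subzn ab); ring.
rewrite -exprnP; ring.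
Qed.

(** The lower parameter q supplies the (q)_k of the kernel, the one of the series itself staying in
    A_k; the argument t q supplies the factor q^k. *)
Lemma qhyp_kernel_termE (R : realType) (q : complexType R)
    (a b : seq (complexType R)) (c t : complexType R) n k :
  (size a < size b)%N ->
  qhyp_term q (q ^- n :: rcons a (c * q ^+ n)) (rcons b q) (t * q) k =
  qcoef q a b (size b - (size a).+1).+1 t k * qkernel q c k n.
Proof.
move=> ab; rewrite /qhyp_term /qcoef /qkernel qpochs_rcons /= !size_rcons.
have -> : 1 + (size b).+1%:Z - (size a).+2%:Z = (size b - (size a).+1).+1%:Z.
  by rewrite -[X in _ = Posz X]addn1 PoszD -(subzn ab) !intS; ring.
have -> : qpochs q (q ^- n :: rcons a (c * q ^+ n)) k =
    qpoch q (q ^- n) k * (qpochs q a k * qpoch q (c * q ^+ n) k).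
  by rewrite -qpochs_rcons /qpochs big_cons.
rewrite -exprnP [(t * q) ^+ k]exprMn invfM; ring.
Qed.

Lemma series_finite (K : numFieldType) (u : K ^nat) n :
  (forall k, (n <= k)%N -> u k = 0) ->
  limn (series u) = \sum_(0 <= k < n) u k.
Proof.
move=> u0; apply: cvg_lim => //; apply: cvg_near_cst.
near=> N; have nN : (n <= N)%N by near: N; exact: nbhs_infty_ge.
rewrite /series/= (@big_cat_nat _ _ _ n)//= [X in _ + X]big_nat_cond.
by rewrite [X in _ + X]big1 ?addr0// => k /andP[/andP[/u0]].
Unshelve. all: by end_near. Qed.

Theorem theorem1p2 (R : realType) (q : complexType R) (r s : nat)
    (a : r.-1.-tuple (complexType R)) (b : s.-tuple (complexType R))
    (c x t : complexType R)
    (q_neq0 : q != 0) (q_lt1 : `|q| < 1)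
    (r_gt0 : (0 < r)%N) (le_rs : (r <= s)%N)
    (x_neq0 : x != 0)
    (hx : forall n : nat, x != q ^- n)
    (hb : forall (i : 'I_s) (n : nat), tnth b i != q ^- n) :
  let lhs_term := qhyp_term q (rcons a (c / x)) b (x * t) in
  let rhs_term := fun n : nat =>
    qhyp q (q ^- n :: rcons a (c * q ^+ n)) (rcons b q) (t * q)
    * (qpoch q (c / x) n / qpoch q x n.+1)
    * (1 - c * q ^+ (2 * n)) * qtau q n * x ^+ n in
  [/\ cvgn (series lhs_term),
      cvgn (series rhs_term) &
      qhyp q (rcons a (c / x)) b (x * t) = limn (series rhs_term)].
Proof.
move=> lhs_term rhs_term.
have ab : (size a < size b)%N by rewrite !size_tuple prednK.
have hb' y : y \in (b : seq _) -> forall k, y != q ^- k.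
  by move=> /tnthP[i ->]; exact: hb.
pose A k := qcoef q a b (size b - (size a).+1).+1 t k.
have [MA MA0 AP] : exists2 M, 0 <= M &
    forall k, cmod (A k) <= cmod q ^+ 'C(k, 2) * M ^+ k.
  exact: qcoef_bound.
have [B [MB [B0 MB0 BP]]] := qpartial_bound R q q_neq0 q_lt1 x hx c.
have [G G0 GP] := geom_boundedM _ _ _ (geom_bounded_exp _ x)
  (geom_bounded_qpoch _ q q_lt1 (c / x)).
have M0 : 0 <= MA * (MB + G) by rewrite mulr_ge0// addr_ge0.
have [C C0 CP] := superexponential_decay R q q_lt1 _ M0.
(* One majorant serves the partial sums, bounded by B MB^k, and their limits x^k (c/x)_k, bounded by
   G^k. *)
have majorant k z : cmod z <= (1 + B) * (MB + G) ^+ k ->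
    cmod (A k * z) <= (1 + B) * C / 2 ^+ k.
  move=> zk; rewrite cmodM -mulrA.
  apply: (@le_trans _ _ ((cmod q ^+ 'C(k, 2) * MA ^+ k) *
      ((1 + B) * (MB + G) ^+ k))).
    by rewrite ler_pM ?cmod_ge0.
  rewrite mulrCA ler_wpM2l ?addr_ge0//.
  by rewrite -mulrA -exprMn.
have lhsE k : lhs_term k = A k * (x ^+ k * qpoch q (c / x) k).
  by rewrite /lhs_term qhyp_termE// /A /qcoef [(x * t) ^+ k]exprMn; ring.
have lhs_le k : cmod (lhs_term k) <= (1 + B) * C / 2 ^+ k.
  rewrite lhsE; apply: majorant; apply: le_trans (GP k) _.
  rewrite -[leLHS]mul1r ler_pM ?exprn_ge0 ?lerDl//.
  by rewrite lerXn2r ?nnegrE ?addr_ge0 ?lerDr.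
have lhs_cvg : cvgn (series lhs_term) := abs_cvg_complex _ _ _ lhs_le.
(* The inner series may be cut at any N > n. A common N for all n < N makes the double sum a square,
   so that the two finite sums can be exchanged. *)
have rhsE n N : (n < N)%N -> rhs_term n =
    \sum_(0 <= k < N) A k * (qweight q x c n * (1 - c * q ^+ (2 * n)) *
      qkernel q c k n).
  move=> nN; rewrite /rhs_term /qhyp (@series_finite _ _ N); last first.
    move=> k Nk; rewrite qhyp_kernel_termE// qkernel_eq0 ?mulr0//.
    exact: leq_trans nN Nk.
  rewrite -!mulrA mulr_suml; apply: eq_bigr => k _.
  rewrite qhyp_kernel_termE// -/(A k) /qweight; ring.
have rhs_sum N : series rhs_term N = \sum_(0 <= k < N) A k * qpartial q x c k N.
  rewrite /series/=.
  have -> : \sum_(0 <= n < N) rhs_term n = \sum_(0 <= n < N) \sum_(0 <= k < N)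
      A k * (qweight q x c n * (1 - c * q ^+ (2 * n)) * qkernel q c k n).
    by apply: eq_big_nat => n /andP[_ nN]; exact: rhsE.
  by rewrite exchange_big_nat/=; apply: eq_bigr => k _; rewrite /qpartial mulr_sumr.
have term_le N k : (k < N)%N ->
    cmod (A k * qpartial q x c k N) <= (1 + B) * C / 2 ^+ k.
  move=> kN; apply: majorant; apply: le_trans (BP k N kN) _.
  apply: ler_pM; rewrite ?exprn_ge0 ?lerDr//.
  by rewrite lerXn2r ?nnegrE ?addr_ge0 ?lerDl.
have term_cvg k : A k * qpartial q x c k N @[N --> \oo] --> lhs_term k.
  rewrite lhsE; apply: cvgM; first exact: cvg_cst.
  exact: qpartial_cvg.
have rhs_cvg : series rhs_term @ \oo --> limn (series lhs_term).
  rewrite (_ : series rhs_term =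
      fun N => \sum_(0 <= k < N) A k * qpartial q x c k N); last first.
    by apply/funext.
  exact: (tannery R (fun N k => A k * qpartial q x c k N) _ _ _
    term_le lhs_le term_cvg lhs_cvg).
split; [exact: lhs_cvg|exact: cvgP rhs_cvg|].
exact: esym (cvg_lim (@norm_hausdorff _ (complexType R)) rhs_cvg).
Qed.
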